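(* Let $\mathfrak X_C := \{\varnothing, \mathbb R^2_\pm, \mathbb R^2_+, \mathbb R^2_-\}$. Then $\mathfrak R_C = \Xi(\mathfrak X_C)$, where $\Xi(\mathfrak X_C) = \{\Xi(X) : X \in \mathfrak X_C\}$. That is, the continuous roots of the family of monic quadratic polynomials $z^2 + a_1 z + a_0$ with real coefficients are exactly the functions $\Xi(\varnothing)$, $\Xi(\mathbb R^2_\pm)$, $\Xi(\mathbb R^2_+)$, $\Xi(\mathbb R^2_-)$.
   Context: For $M=(a_0,a_1)\in\mathbb R^2$ and $z\in\mathbb C$ put $F^2(M,z) := z^2 + a_1 z + a_0$, and let $D(a_0,a_1) := a_1^2 - 4a_0$ be the discriminant. A root of the family of real monic quadratics is a function $r:\mathbb R^2\to\mathbb C$ (not assumed continuous) such that $F^2(M,r(M))=0$ for every $M\in\mathbb R^2$. Let $\mathfrak R$ be the set of all such roots, and let $\mathfrak R_C$ be the set of those $r\in\mathfrak R$ that are continuous on $\mathbb R^2$. Let $\mathbb R^2_0 := \{(x,y)\in\mathbb R^2 : 4x = y^2\}$, $\mathbb R^2_+ := \{(x,y)\in\mathbb R^2 : 4x < y^2\}$, $\mathbb R^2_- := \{(x,y)\in\mathbb R^2 : 4x > y^2\}$, $\mathbb R^2_\pm := \mathbb R^2\setminus\mathbb R^2_0 = \mathbb R^2_+\cup\mathbb R^2_-$, and let $\mathfrak X$ be the set of all subsets of $\mathbb R^2_\pm$. For $X\in\mathfrak X$ and $M\in\mathbb R^2$ define $S(X,M) := -1$ if $M\in X$, $S(X,M):=0$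 if $M\in\mathbb R^2_0$, and $S(X,M):=+1$ if $M\in\mathbb R^2_\pm\setminus X$. For $X\in\mathfrak X$ let $\Xi(X):\mathbb R^2\to\mathbb C$ be the function $$\Xi(X)(a_0,a_1) := \begin{cases} -\dfrac{a_1}{2} + S(X,(a_0,a_1))\,\dfrac{\sqrt{D(a_0,a_1)}}{2}, & (a_0,a_1)\in\mathbb R^2_+,\\[1ex] -\dfrac{a_1}{2}, & (a_0,a_1)\in\mathbb R^2_0,\\[1ex] -\dfrac{a_1}{2} + S(X,(a_0,a_1))\,\dfrac{\sqrt{-D(a_0,a_1)}}{2}\, i, & (a_0,a_1)\in\mathbb R^2_-,\end{cases}$$ where $i$ is the imaginary unit and the square roots are the nonnegative real ones. *)

(* Defs.v *)
(* Stdlib + Coquelicot: R is the Stdlib reals, C is Coquelicot's complex plane. *)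
From Stdlib Require Import Reals Lra Ensembles Image ClassicalEpsilon.
From Coquelicot Require Import Coquelicot.
Open Scope R_scope.

(* A point M = (a0, a1) lists the coefficients from the constant term up. *)
Definition F2 (M : R * R) (z : C) : C :=
  (z ^ 2 + RtoC (snd M) * z + RtoC (fst M))%C.

Definition discr (M : R * R) : R := snd M ^ 2 - 4 * fst M.

Definition frakR : Ensemble (R * R -> C) :=
  fun r => forall M : R * R, F2 M (r M) = RtoC 0.

Definition frakRC : Ensemble (R * R -> C) :=
  fun r => In _ frakR r /\ forall M : R * R, continuous r M.

Definition R2_zero : Ensemble (R * R) := fun M => 4 * fst M = snd M ^ 2.
Definition R2_plus : Ensemble (R * R) := fun M => 4 * fst M < snd M ^ 2.
Definition R2_minus : Ensemble (R * R) := fun M => 4 * fst M > snd M ^ 2.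
Definition R2_pm : Ensemble (R * R) := Complement _ R2_zero.

Lemma R2_pm_union : Same_set _ R2_pm (Union _ R2_plus R2_minus).
Proof.
split; intros M HM.
- destruct (Rtotal_order (4 * fst M) (snd M ^ 2)) as [H | [H | H]].
  + now left.
  + now destruct HM.
  + now right.
- destruct HM as [M HM | M HM];
    unfold R2_pm, Complement, In, R2_plus, R2_minus, R2_zero in *; lra.
Qed.

Definition frakX : Ensemble (Ensemble (R * R)) := fun X => Included _ X R2_pm.

(* sgn_in X M is S(X, M).  It and Xi accept any set X, but are meant for X in
   frakX, where the test M in X excludes R2_zero. *)
Definition sgn_in (X : Ensemble (R * R)) (M : R * R) : R :=
  if excluded_middle_informative (In _ X M) then -1
  else if excluded_middle_informative (In _ R2_zero M) then 0
  else 1.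

Definition Xi (X : Ensemble (R * R)) (M : R * R) : C :=
  if excluded_middle_informative (In _ R2_plus M) then
    (RtoC (- snd M / 2) + RtoC (sgn_in X M) * RtoC (sqrt (discr M) / 2))%C
  else if excluded_middle_informative (In _ R2_zero M) then
    RtoC (- snd M / 2)
  else (* M in R2_minus, by trichotomy *)
    (RtoC (- snd M / 2) + RtoC (sgn_in X M) * RtoC (sqrt (- discr M) / 2) * Ci)%C.

Definition frakXC : Ensemble (Ensemble (R * R)) :=
  fun X => X = Empty_set _ \/ X = R2_pm \/ X = R2_plus \/ X = R2_minus.

Lemma frakXC_frakX : Included _ frakXC frakX.
Proof.
intros X [-> | [-> | [-> | ->]]] M HM.
- destruct HM.
- exact HM.
- unfold R2_pm, Complement, In, R2_plus, R2_zero in *; lra.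
- unfold R2_pm, Complement, In, R2_minus, R2_zero in *; lra.
Qed.

(* Main.v *)
Require Import Defs.
From Stdlib Require Import Reals Ensembles Image.
From Stdlib Require Import Lra FunctionalExtensionality ClassicalEpsilon.
From Coquelicot Require Import Coquelicot.

(** In the coordinates (d, a1), where d is plus or minus the discriminant, each of the two
    open regions becomes the half-plane d > 0, which is convex.  There the relevant component
    of a continuous root, shifted by a1 / 2, is a continuous choice of a nonzero value
    + sqrt d / 2 or - sqrt d / 2, so its sign is constant by the intermediate value theorem.
    The two independent signs give the four roots. *)

(* Stdlib's [sqrt] vanishes on negative numbers, so this single formula covers both regions. *)
Definition signed_root (e1 e2 : R) (M : R * R) : C :=
  (- snd M / 2 + e1 * (sqrt (discr M) / 2), e2 * (sqrt (- discr M) / 2)).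

Lemma continuous_pair {U V W : UniformSpace} (f : U -> V) (g : U -> W) (x : U) :
  continuous f x -> continuous g x -> continuous (fun y => (f y, g y)) x.
Proof.
intros Hf Hg.
apply (continuous_comp_2 f g (fun a b => (a, b))); auto.
apply continuous_ext with (f := fun z : V * W => z).
- now intros [a b].
- apply continuous_id.
Qed.

(** A zero of [f] forces [sqrt (fst p) = 0], so [f] cannot change sign along a segment inside the
    half-plane where [fst p] is positive; every point there is compared with the base point
    [(1, 0)]. *)
Lemma continuous_sign_constant (f : R * R -> R) :
  (forall p, continuous f p) ->
  (forall p, f p = sqrt (fst p) / 2 \/ f p = - (sqrt (fst p) / 2)) ->
  exists e, (e = 1 \/ e = -1) /\ forall p, f p = e * (sqrt (fst p) / 2).
Proof.
intros Hc Hf.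
assert (Hsame : forall d a, 0 < d -> f (1, 0) * f (d, a) < 0 -> False).
{ intros d a Hd Hneg.
  (* [g] is [f] along the segment from [(1, 0)] to [(d, a)]. Its first coordinate is a convex
     combination of [1] and [d], hence stays positive. *)
  set (g := fun t => f (1 + t * (d - 1), t * a)).
  assert (Hg0 : g 0 = f (1, 0)) by (unfold g; f_equal; f_equal; ring).
  assert (Hg1 : g 1 = f (d, a)) by (unfold g; f_equal; f_equal; ring).
  assert (Hgc : continuity g).
  { intros t; apply continuity_pt_filterlim.
    apply (continuous_comp (fun t => (1 + t * (d - 1), t * a)) f); [|apply Hc].
    apply (continuous_pair (V := R_UniformSpace) (W := R_UniformSpace));
      apply (@ex_derive_continuous _ R_NormedModule); auto_derive; auto. }
  destruct (IVT_gen g 0 1 0 Hgc) as [t [Ht Hgt]].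
  { rewrite Hg0, Hg1; unfold Rmin, Rmax.
    destruct (Rle_dec (f (1, 0)) (f (d, a))); nra. }
  rewrite Rmin_left, Rmax_right in Ht by lra.
  assert (Hpos : 0 < sqrt (1 + t * (d - 1))) by (apply sqrt_lt_R0; nra).
  unfold g in Hgt.
  destruct (Hf (1 + t * (d - 1), t * a)) as [H | H]; simpl in H; lra. }
assert (H10 : f (1, 0) = 1 / 2 \/ f (1, 0) = - (1 / 2)).
{ generalize (Hf (1, 0)); simpl; now rewrite sqrt_1. }
(* At the base point the square root is 1, so [f (1, 0)] is half the sign sought. *)
exists (2 * f (1, 0)); split; [lra|].
intros [d a]; specialize (Hsame d a); generalize (Hf (d, a)); simpl.
destruct (Rle_or_lt d 0) as [Hd | Hd].
(* Here [sqrt d] takes its default value 0, so both alternatives give [f = 0] and any sign fits. *)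
- rewrite sqrt_neg_0 by exact Hd; intros; nra.
- generalize (sqrt_lt_R0 d Hd); intros Hs [H | H]; rewrite H in *;
    destruct H10 as [E | E]; rewrite E in *;
    try (exfalso; apply Hsame; nra); lra.
Qed.

(** Completing the square turns the equation into [4 * (z + a1 / 2) ^ 2 = discr M]; the two
    conditions are its real and imaginary parts. *)
Lemma F2_root_iff (M : R * R) (z : C) :
  F2 M z = RtoC 0 <->
  4 * (fst z + snd M / 2) ^ 2 - 4 * snd z ^ 2 = discr M /\
  (fst z + snd M / 2) * snd z = 0.
Proof.
destruct M as [a0 a1], z as [u v]; unfold F2, discr; simpl.
unfold Cplus, Cmult, RtoC; simpl; split.
- intros H; injection H; intros; split; nra.
- intros [H1 H2]; f_equal; nra.
Qed.

(** The vanishing product kills one component of the shifted root. The other one then determines the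
    sign of the discriminant, which makes the square root paired with the zero component vanish
    too. *)
Lemma F2_root_components (M : R * R) (z : C) :
  F2 M z = RtoC 0 ->
  (fst z + snd M / 2 = sqrt (discr M) / 2 \/ fst z + snd M / 2 = - (sqrt (discr M) / 2)) /\
  (snd z = sqrt (- discr M) / 2 \/ snd z = - (sqrt (- discr M) / 2)).
Proof.
assert (Hsq : forall x d, 4 * x ^ 2 = d -> x = sqrt d / 2 \/ x = - (sqrt d / 2)).
{ intros x d <-; replace (4 * x ^ 2) with (Rsqr (2 * x)) by (unfold Rsqr; ring).
  rewrite sqrt_Rsqr_abs; unfold Rabs; destruct (Rcase_abs (2 * x)); lra. }
rewrite F2_root_iff; intros [H1 H2].
set (w := fst z + snd M / 2) in *; set (v := snd z) in *.
destruct (Rmult_integral _ _ H2) as [H | H]; rewrite H in *.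
- split; [|apply Hsq; lra].
  rewrite sqrt_neg_0 by nra; lra.
- split; [apply Hsq; lra|].
  rewrite (sqrt_neg_0 (- discr M)) by nra; lra.
Qed.

Lemma signed_root_frakR (e1 e2 : R) :
  e1 ^ 2 = 1 -> e2 ^ 2 = 1 -> In _ frakR (signed_root e1 e2).
Proof.
intros H1 H2 M; apply F2_root_iff; unfold signed_root; simpl fst; simpl snd.
replace (- snd M / 2 + e1 * (sqrt (discr M) / 2) + snd M / 2)
  with (e1 * (sqrt (discr M) / 2)) by field.
rewrite !Rpow_mult_distr, H1, H2.
destruct (Rle_or_lt 0 (discr M)) as [H | H].
- rewrite (sqrt_neg_0 (- discr M)) by lra.
  generalize (sqrt_sqrt _ H); intros; split; nra.
- rewrite (sqrt_neg_0 (discr M)) by lra.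
  assert (H' : 0 <= - discr M) by lra.
  generalize (sqrt_sqrt _ H'); intros; split; nra.
Qed.

Lemma continuous_discr (M : R * R) : continuous discr M.
Proof.
apply (continuous_minus (V := R_NormedModule) (fun M => snd M ^ 2) (fun M => 4 * fst M)).
- apply (continuous_comp snd (fun x => x ^ 2)); [apply continuous_snd|].
  apply (@ex_derive_continuous _ R_NormedModule); auto_derive; auto.
- apply (continuous_scal_r (V := R_NormedModule) 4 fst), continuous_fst.
Qed.

Lemma continuous_signed_root (e1 e2 : R) (M : R * R) : continuous (signed_root e1 e2) M.
Proof.
(* The factor [s] is used with values 1 and -1, for the real and the imaginary part. *)
assert (Hs : forall e s, continuous (fun M => e * (sqrt (s * discr M) / 2)) M).
{ intros e s.
  apply (continuous_scal_r (V := R_NormedModule) e (fun M => sqrt (s * discr M) / 2)).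
  apply (continuous_scal_l (V := R_NormedModule) (fun M => sqrt (s * discr M)) (/ 2)).
  apply (continuous_comp (fun M => s * discr M) sqrt); [|apply continuous_sqrt].
  apply (continuous_scal_r (V := R_NormedModule) s discr), continuous_discr. }
apply (continuous_pair (V := R_UniformSpace) (W := R_UniformSpace)).
- apply (continuous_plus (V := R_NormedModule)
    (fun M => - snd M / 2) (fun M => e1 * (sqrt (discr M) / 2))).
  + apply (continuous_comp snd (fun x => - x / 2)); [apply continuous_snd|].
    apply (@ex_derive_continuous _ R_NormedModule); auto_derive; auto.
  + apply continuous_ext with (2 := Hs e1 1).
    intros; now rewrite Rmult_1_l.
- apply continuous_ext with (2 := Hs e2 (-1)).
  intros; do 3 f_equal; ring.
Qed.

Lemma continuous_root_signed_root (r : R * R -> C) :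
  In _ frakRC r ->
  exists e1 e2, (e1 = 1 \/ e1 = -1) /\ (e2 = 1 \/ e2 = -1) /\ r = signed_root e1 e2.
Proof.
intros [Hr Hc].
(* For [s] equal to 1 or -1, [coef s] recovers the coefficients from the coordinates
   [(s * discr M, snd M)]. It is defined and continuous on the whole plane, so composing it with [r]
   stays continuous. *)
set (coef := fun (s : R) (p : R * R) => ((snd p ^ 2 - s * fst p) / 4, snd p) : R * R).
assert (Hcoef : forall s p, continuous (coef s) p).
{ intros s p.
  apply (continuous_pair (V := R_UniformSpace) (W := R_UniformSpace)); [|apply continuous_snd].
  apply (continuous_scal_l (V := R_NormedModule) (fun p => snd p ^ 2 - s * fst p) (/ 4)).
  apply (continuous_minus (V := R_NormedModule) (fun p => snd p ^ 2) (fun p => s * fst p)).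
  - apply (continuous_comp snd (fun x => x ^ 2)); [apply continuous_snd|].
    apply (@ex_derive_continuous _ R_NormedModule); auto_derive; auto.
  - apply (continuous_scal_r (V := R_NormedModule) s fst), continuous_fst. }
assert (Hrc : forall s p, continuous (fun p => r (coef s p)) p).
{ intros s p; apply (continuous_comp (coef s) r); auto. }
assert (Hdiscr : forall s p, discr (coef s p) = s * fst p).
{ intros; unfold discr, coef; simpl; field. }
destruct (continuous_sign_constant (fun p => fst (r (coef 1 p)) + snd p / 2)) as [e1 [He1 H1]].
{ intros p.
  apply (continuous_plus (V := R_NormedModule)
    (fun p => fst (r (coef 1 p))) (fun p => snd p / 2)).
  - apply (continuous_comp (fun p => r (coef 1 p)) fst); [apply Hrc | apply continuous_fst].
  - apply (continuous_scal_l (V := R_NormedModule) snd (/ 2)), continuous_snd. }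
{ intros p; destruct (F2_root_components _ _ (Hr (coef 1 p))) as [H _].
  now rewrite Hdiscr, Rmult_1_l in H. }
destruct (continuous_sign_constant (fun p => snd (r (coef (-1) p)))) as [e2 [He2 H2]].
{ intros p.
  apply (continuous_comp (fun p => r (coef (-1) p)) snd); [apply Hrc | apply continuous_snd]. }
{ intros p; destruct (F2_root_components _ _ (Hr (coef (-1) p))) as [_ H].
  rewrite Hdiscr in H; now replace (- (-1 * fst p)) with (fst p) in H by ring. }
exists e1, e2; repeat split; auto.
apply functional_extensionality; intros M.
(* The condition [s * s = 1] makes multiplication by [s] its own inverse, so the coordinate change
   can be undone. *)
assert (HM : forall s, s * s = 1 -> coef s (s * discr M, snd M) = M).
{ intros s Hs; destruct M as [a0 a1]; unfold coef, discr; simpl; f_equal.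
  replace (s * (s * (a1 * (a1 * 1) - 4 * a0)))
    with (s * s * (a1 * (a1 * 1) - 4 * a0)) by ring.
  rewrite Hs; field. }
specialize (H1 (1 * discr M, snd M)); specialize (H2 (-1 * discr M, snd M)).
rewrite HM in H1, H2 by ring; simpl in H1, H2.
rewrite Rmult_1_l in H1; replace (-1 * discr M) with (- discr M) in H2 by ring.
unfold signed_root; apply injective_projections; simpl; lra.
Qed.

(** On each open region one of the two square roots in [signed_root] vanishes and the other gives
    the matching branch of [Xi]; on [R2_zero] both vanish. *)
Lemma Xi_signed_root (X : Ensemble (R * R)) (e1 e2 : R) :
  (forall M, In _ R2_plus M -> sgn_in X M = e1) ->
  (forall M, In _ R2_minus M -> sgn_in X M = e2) ->
  Xi X = signed_root e1 e2.
Proof.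
intros H1 H2; apply functional_extensionality; intros M.
specialize (H1 M); specialize (H2 M).
unfold Xi, signed_root, In, R2_plus, R2_zero, R2_minus, discr in *.
destruct (excluded_middle_informative _) as [Hp | Hp];
  [|destruct (excluded_middle_informative _) as [Hz | Hz]].
- rewrite H1, (sqrt_neg_0 (- _)) by lra.
  apply injective_projections; simpl; field.
- rewrite (sqrt_neg_0 (- _)), sqrt_neg_0 by lra.
  apply injective_projections; simpl; field.
- rewrite H2, (sqrt_neg_0 (_ - _)) by lra.
  apply injective_projections; simpl; field.
Qed.

Lemma sgn_in_mem (X : Ensemble (R * R)) (M : R * R) : In _ X M -> sgn_in X M = -1.
Proof.
intros H; unfold sgn_in; now destruct (excluded_middle_informative (In _ X M)).
Qed.

Lemma sgn_in_not_mem (X : Ensemble (R * R)) (M : R * R) :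
  In _ R2_pm M -> ~ In _ X M -> sgn_in X M = 1.
Proof.
intros HM H; unfold sgn_in.
destruct (excluded_middle_informative (In _ X M)); [easy|].
now destruct (excluded_middle_informative (In _ R2_zero M)).
Qed.

Ltac solve_sgn_in :=
  intros M HM; first
    [ apply sgn_in_mem; unfold R2_pm, Complement, In, R2_plus, R2_minus, R2_zero in *; lra
    | apply sgn_in_not_mem;
      [ unfold R2_pm, Complement, In, R2_plus, R2_minus, R2_zero in *; lra
      | try (now intros []);
        unfold R2_pm, Complement, In, R2_plus, R2_minus, R2_zero in *; lra ] ].

Lemma Xi_empty : Xi (Empty_set _) = signed_root 1 1.
Proof. apply Xi_signed_root; solve_sgn_in. Qed.

Lemma Xi_pm : Xi R2_pm = signed_root (-1) (-1).
Proof. apply Xi_signed_root; solve_sgn_in. Qed.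

Lemma Xi_plus : Xi R2_plus = signed_root (-1) 1.
Proof. apply Xi_signed_root; solve_sgn_in. Qed.

Lemma Xi_minus : Xi R2_minus = signed_root 1 (-1).
Proof. apply Xi_signed_root; solve_sgn_in. Qed.

Theorem mainTheorem1 : Same_set _ frakRC (Image.Im _ _ frakXC Xi).
Proof.
split; intros r Hr.
(* A sign -1 on a region means that the region is contained in [X], so the four sign pairs single
   out the four sets. *)
- destruct (continuous_root_signed_root r Hr) as [e1 [e2 [[-> | ->] [[-> | ->] ->]]]].
  + apply Im_intro with (Empty_set _); [now left | now rewrite Xi_empty].
  + apply Im_intro with R2_minus; [now do 3 right | now rewrite Xi_minus].
  + apply Im_intro with R2_plus; [now right; right; left | now rewrite Xi_plus].
  + apply Im_intro with R2_pm; [now right; left | now rewrite Xi_pm].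
- assert (H : forall e1 e2, e1 ^ 2 = 1 -> e2 ^ 2 = 1 -> In _ frakRC (signed_root e1 e2)).
  { intros e1 e2 H1 H2; split; [now apply signed_root_frakR|].
    apply continuous_signed_root. }
  destruct Hr as [X HX r ->].
  destruct HX as [-> | [-> | [-> | ->]]];
    rewrite ?Xi_empty, ?Xi_pm, ?Xi_plus, ?Xi_minus; apply H; ring.
Qed.
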